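(* Let $N_1,N_2,N_3,N_4$ be positive integers with $N_1N_2N_3N_4>1$, and put $\Sigma=N_1+N_2+N_3+N_4$, $\Pi=N_1N_2N_3N_4$, $\Gamma_0=N_1N_3+N_2N_4$, and $\Delta=\Sigma^2+4(\Pi+1-\Gamma_0)$. Then the Perron eigenvalue of the matrix $$A=\begin{pmatrix}0&N_1&0&1\\1&0&N_2&0\\0&1&0&N_3\\N_4&0&1&0\end{pmatrix}$$ is $$\lambda(A)=\sqrt{\tfrac12\bigl(\Sigma+\sqrt{\Delta}\bigr)}.$$
   Context: The Perron eigenvalue of a non-negative irreducible square matrix is its spectral radius, which is an eigenvalue. *)

(* Defs.v *)
From HB Require Import structures.
From mathcomp Require Import all_boot all_order all_algebra.
From mathcomp Require Import complex.
From mathcomp Require Import all_classical all_reals.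

Set Implicit Arguments.
Unset Strict Implicit.
Unset Printing Implicit Defensive.

Import Order.TTheory GRing.Theory Num.Theory.

Local Open Scope classical_set_scope.
Local Open Scope complex_scope.
Local Open Scope ring_scope.

Definition nonneg_mx (R : realType) (n : nat) (A : 'M[R]_n) : Prop :=
  forall i j, 0 <= A i j.

(* For a nonnegative A, (A ^+ k) i j > 0 iff the digraph with an arc i -> j
   whenever A i j > 0 has a walk of length k from i to j: this is strong
   connectedness of that digraph. Requiring k > 0 excludes the 1 x 1 zero
   matrix. *)
Definition irreducible_mx (R : realType) (n : nat) (A : 'M[R]_n) : Prop :=
  forall i j, exists2 k : nat, (0 < k)%N & 0 < (A ^+ k) i j.

(* All complex eigenvalues are taken into account, not only the real ones.
   [eigenvalue] is stated with row eigenvectors, which for a square matrix over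
   a field gives the same eigenvalues as column eigenvectors. *)
Definition complex_spectrum (R : realType) (n : nat) (A : 'M[R]_n) : set R[i] :=
  [set z | eigenvalue (map_mx (real_complex R) A) z].

Definition spectral_radius (R : realType) (n : nat) (A : 'M[R]_n) : R :=
  sup [set Normc.normc z | z in complex_spectrum A].

Definition is_perron_eigenvalue (R : realType) (n : nat) (A : 'M[R]_n)
    (l : R) : Prop :=
  [/\ nonneg_mx A, irreducible_mx A, eigenvalue A l & spectral_radius A = l].

Definition cycle_mx (R : realType) (N1 N2 N3 N4 : nat) : 'M[R]_4 :=
  \matrix_(i < 4, j < 4)
    nth 0 (nth [::] [:: [:: 0;     N1%:R; 0;     1    ];
                        [:: 1;     0;     N2%:R; 0    ];
                        [:: 0;     1;     0;     N3%:R];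
                        [:: N4%:R; 0;     1;     0    ]] i) j.

(* Main.v *)
Require Import Defs.
From HB Require Import structures.
From mathcomp Require Import all_boot all_order all_algebra.
From mathcomp Require Import complex.
From mathcomp Require Import all_classical all_reals.
From mathcomp Require Import ring lra.

Set Implicit Arguments.
Unset Strict Implicit.
Unset Printing Implicit Defensive.

Import Order.TTheory GRing.Theory Num.Theory.

Local Open Scope ring_scope.

(** The characteristic polynomial of the matrix is biquadratic, namely
    X^4 - Sigma X^2 + (Gamma0 - Pi - 1) = (X^2 - p) (X^2 - q) with
    p, q = (Sigma +- sqrt Delta) / 2, and Delta > 0 because
    Sigma^2 >= (N1 + N3)^2 + (N2 + N4)^2 >= 4 Gamma0. Hence every complex
    eigenvalue z has |z|^2 in {p, |q|}, and |q| <= p since Sigma >= 0: the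
    spectral radius is sqrt p, without appeal to the Perron-Frobenius theorem.
    Irreducibility holds because the digraph contains a Hamiltonian cycle. *)

Lemma nonneg_mxX (R : realType) (n : nat) (A : 'M[R]_n) (k : nat) :
  nonneg_mx A -> nonneg_mx (A ^+ k).
Proof.
move=> A0; elim: k => [|k IHk] i j; first by rewrite expr0 mxE; case: eqP.
by rewrite exprSr mxE sumr_ge0 // => l _; rewrite mulr_ge0.
Qed.

(** Indices add modulo [n.+2], so the arcs [i -> i + 1] close up into a Hamiltonian cycle, and
    following it for [k] steps leads from [i] to [i + k]. *)
Lemma cyclic_irreducible_mx (R : realType) (n : nat) (A : 'M[R]_n.+2) :
  nonneg_mx A -> (forall i : 'I_n.+2, 0 < A i (i + 1)) -> irreducible_mx A.
Proof.
move=> A0 Acyc.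
have walk k (i : 'I_n.+2) : 0 < (A ^+ k) i (i + k%:R).
  elim: k => [|k IHk]; first by rewrite addr0 expr0 mxE eqxx.
  rewrite exprSr mxE (bigD1 (i + k%:R)) //= ltr_wpDr //.
    by rewrite sumr_ge0 // => l _; rewrite mulr_ge0 //; exact: nonneg_mxX.
  by rewrite mulr_gt0 // mulrSr addrA.
(* Adding a full turn [n.+2] to the distance [j - i] keeps the length positive even when [i = j]. *)
move=> i j; exists (n.+2 + (j - i)%R)%N; first by rewrite addSn.
have {2}<- : i + (n.+2 + (j - i)%R)%N%:R = j.
  have -> : (n.+2 + (j - i)%R)%N%:R = j - i :> 'I_n.+2.
    have n2_0 : n.+2%:R = 0 :> 'I_n.+2 := @pchar_Zp n.+2 isT.
    by rewrite natrD n2_0 add0r natr_Zp.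
  by rewrite addrC subrK.
exact: walk.
Qed.

(** [q] may be negative, its two roots then being purely imaginary; hence the comparison of moduli.
    The bound on [q] also forces [0 <= p]. *)
Lemma biquadratic_spectral_radius (R : realType) (n : nat) (A : 'M[R]_n)
    (p q : R) :
    char_poly A = ('X ^+ 2 - p%:P) * ('X ^+ 2 - q%:P) -> `|q| <= p ->
  eigenvalue A (Num.sqrt p) /\ spectral_radius A = Num.sqrt p.
Proof.
move=> charA le_qp; have p0 : 0 <= p := le_trans (normr_ge0 q) le_qp.
have eigA : eigenvalue A (Num.sqrt p).
  by rewrite eigenvalue_root_char charA rootM /root !hornerE sqr_sqrtr ?subrr ?eqxx.
have normE (x : R) : Normc.normc (real_complex R x) = `|x|.
  by rewrite /= expr0n addr0 sqrtr_sqr.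
split=> //; apply/eqP; rewrite eq_le; apply/andP.
have sqrtp_in : [set Normc.normc z | z in complex_spectrum A]%classic (Num.sqrt p).
  exists (real_complex R (Num.sqrt p)).
    rewrite /complex_spectrum /= eigenvalue_root_char -map_char_poly.
    by rewrite fmorph_root -eigenvalue_root_char.
  by rewrite normE ger0_norm ?sqrtr_ge0.
have ubp : ubound [set Normc.normc z | z in complex_spectrum A]%classic (Num.sqrt p).
  move=> _ [z /= + <-]; rewrite /complex_spectrum /= eigenvalue_root_char.
  rewrite -map_char_poly charA !(rmorphM, rmorphB, rmorphXn) /= !map_polyX !map_polyC.
  have z0 : 0 <= Normc.normc z by case: (z) => a b; rewrite sqrtr_ge0.
  have normz r : r%:C%C = z ^+ 2 -> Normc.normc z ^+ 2 = `|r|.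
    by move=> /(congr1 (@Normc.normc R)); rewrite normE => ->; rewrite !expr2 Normc.normcM.
  suff le_sqr : Normc.normc z ^+ 2 <= p -> Normc.normc z <= Num.sqrt p.
    rewrite rootM /root !hornerE !subr_eq0 => /orP[] /eqP/esym/normz zE.
      by apply: le_sqr; rewrite zE ger0_norm.
    by apply: le_sqr; rewrite zE.
  by move=> /ler_wsqrtr; rewrite sqrtr_sqr ger0_norm.
split; first by apply: ge_sup => //; exists (Num.sqrt p).
by apply: ub_le_sup => //; exists (Num.sqrt p).
Qed.

Lemma char_poly_cycle_mx (R : realType) (N1 N2 N3 N4 : nat) :
  char_poly (cycle_mx R N1 N2 N3 N4) =
  'X ^+ 4 - (N1 + N2 + N3 + N4)%:R *: 'X ^+ 2
  + ((N1 * N3 + N2 * N4)%:R - (N1 * N2 * N3 * N4)%:R - 1)%:P.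
Proof.
rewrite /char_poly /cycle_mx.
(* Laplace expansion along the first row, repeated down to 0 x 0 determinants. *)
do ![rewrite (expand_det_row _ ord0) !(big_ord_recl, big_ord0) /cofactor /=
   ; rewrite ?mxE /= ?polyC0 ?(mulr0n, subr0, oppr0, mul0r, add0r, addr0)].
rewrite ?det_mx00 /= -mul_polyC.
rewrite !(natrD, natrM, rmorphB, rmorphD, rmorphM, rmorph1, rmorph0) /=.
ring.
Qed.

Theorem mainTheorem6 (R : realType) (N1 N2 N3 N4 : nat)
    (hN1 : (0 < N1)%N) (hN2 : (0 < N2)%N) (hN3 : (0 < N3)%N) (hN4 : (0 < N4)%N)
    (hN : (1 < N1 * N2 * N3 * N4)%N) :
  let Sigma : R := (N1 + N2 + N3 + N4)%:R in
  let Pi : R := (N1 * N2 * N3 * N4)%:R in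
  let Gamma0 : R := (N1 * N3 + N2 * N4)%:R in
  let Delta : R := Sigma ^+ 2 + 4 * (Pi + 1 - Gamma0) in
  is_perron_eigenvalue (cycle_mx R N1 N2 N3 N4)
    (Num.sqrt (2^-1 * (Sigma + Num.sqrt Delta))).
Proof.
move=> Sigma Pi Gamma0 Delta.
have Sigma0 : 0 <= Sigma by rewrite ler0n.
have Delta0 : 0 <= Delta.
  have Pi0 : 0 <= Pi by rewrite ler0n.
  (* Delta = (N1 - N3)^2 + (N2 - N4)^2 + 2 (N1 + N3) (N2 + N4) + 4 (Pi + 1). *)
  have := sqr_ge0 (N1%:R - N3%:R : R); have := sqr_ge0 (N2%:R - N4%:R : R).
  have : 0 <= ((N1 + N3) * (N2 + N4))%:R :> R by rewrite ler0n.
  rewrite /Delta /Sigma /Gamma0 !(natrD, natrM); nra.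
have := sqr_sqrtr Delta0; have := sqrtr_ge0 Delta.
set s := Num.sqrt Delta => s0 s2.
have nonnegA : nonneg_mx (cycle_mx R N1 N2 N3 N4).
  by case=> [[|[|[|[|//]]]] i] [[|[|[|[|//]]]] j]; rewrite mxE /= ?ler0n ?ler01.
have charA : char_poly (cycle_mx R N1 N2 N3 N4) =
    ('X ^+ 2 - (2^-1 * (Sigma + s))%:P) * ('X ^+ 2 - (2^-1 * (Sigma - s))%:P).
  set p := 2^-1 * _; set q := 2^-1 * _.
  have pDq : Sigma = p + q by rewrite /p /q; field.
  have pMq : Gamma0 - Pi - 1 = p * q.
    have -> : p * q = 4^-1 * (Sigma ^+ 2 - s ^+ 2) by rewrite /p /q; field.
    by rewrite s2 /Delta; field.
  rewrite char_poly_cycle_mx -/Sigma -/Gamma0 -/Pi pDq pMq -mul_polyC.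
  by move: p q {pDq pMq} => p q; rewrite polyCD polyCM; ring.
(* The lower bound amounts to [0 <= Sigma], the upper one to [0 <= s]. *)
have le_qp : `|2^-1 * (Sigma - s)| <= 2^-1 * (Sigma + s).
  by rewrite ler_norml; apply/andP; split; lra.
have [eigA radA] := biquadratic_spectral_radius charA le_qp.
(* The arcs of the cycle 0 -> 1 -> 2 -> 3 -> 0 carry the entries N1, N2, N3, N4. *)
split=> //; apply: cyclic_irreducible_mx => // -[[|[|[|[|//]]]] i];
  by rewrite mxE /= ?ltr0n ?ltr01.
Qed.
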